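(* For every integer $n\ge0$, the ascent generating polynomial of Riordan sequences $\mathrm{asc}_{\mathcal{RP}(n)}(t)=\sum_{\mathbf w\in\mathcal{RP}(n)}t^{\mathrm{asc}(\mathbf w)}$ is real-rooted.
   Context: $\mathcal{RP}(n)$ is the set of Riordan sequences of size $n$: sequences $\mathbf w=(w_1,\dots,w_n)$ of positive integers with $w_1=w_n=1$, $|w_i-w_{i+1}|\le1$ for $1\le i<n$, and no index $i$ with $w_i=w_{i+1}=1$ (for $n=0$, only the empty sequence, so the polynomial is the constant $1$). $\mathrm{asc}(\mathbf w)$ is the number of indices $i\in\{1,\dots,n-1\}$ with $w_i<w_{i+1}$. A real polynomial is real-rooted if all its zeros are real; constant polynomials, including the zero polynomial, count as real-rooted. *)

(* Defs.v *)
From HB Require Import structures.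
From mathcomp Require Import all_boot all_order all_algebra.
From mathcomp Require Import reals.
From mathcomp Require Import complex.

Set Implicit Arguments.
Unset Strict Implicit.
Unset Printing Implicit Defensive.

Import Order.TTheory GRing.Theory Num.Theory.
Local Open Scope ring_scope.

Definition riordan_step (a b : nat) : bool :=
  [&& (a <= b.+1)%N, (b <= a.+1)%N & ~~ ((a == 1%N) && (b == 1%N))].

(* The default value 1 of [head] and [last] makes the empty sequence a Riordan
   sequence (of size 0). *)
Definition riordan (w : seq nat) : bool :=
  [&& all (fun a => 0 < a)%N w, head 1%N w == 1%N, last 1%N w == 1%N
    & sorted riordan_step w].

Definition asc (w : seq nat) : nat :=
  #|[set i : 'I_(size w).-1 | (nth 0 w i < nth 0 w i.+1)%N]|.

(* The entries are stored in 'I_n.+1 = {0, ..., n} only to have a finite type;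
   [RP_complete] shows that this loses no Riordan sequence of size n. *)
Definition RP (n : nat) : {set n.-tuple 'I_n.+1} :=
  [set w : n.-tuple 'I_n.+1 | riordan (map val w)].

Lemma riordan_le_size (w : seq nat) (a : nat) :
  riordan w -> a \in w -> (a <= size w)%N.
Proof.
have path_le x s : path riordan_step x s ->
    {in x :: s, forall y, (y <= x + size s)%N}.
  elim: s x => [|z s IHs] x /=; first by move=> _ y; rewrite inE addn0 => /eqP->.
  case/andP=> /and3P[_ lezx _] /IHs{}IHs y.
  rewrite inE => /predU1P[->|/IHs leyz]; first exact: leq_addr.
  by apply: leq_trans leyz _; rewrite addnS -addSn leq_add2r.
case: w => [|x s] //= /and4P[_ /= /eqP-> _ /path_le le_s] /le_s.
by rewrite add1n.
Qed.

Lemma RP_complete (n : nat) (w : seq nat) :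
  (size w == n) && riordan w <-> exists2 u, u \in RP n & map val u = w.
Proof.
split=> [/andP[/eqP sz_w Rw]|[u]]; last first.
  by rewrite inE => Ru <-; rewrite Ru size_map size_tuple eqxx.
have Ew : map val (map (@inord n) w) = w.
  rewrite -map_comp map_id_in // => a wa /=.
  by rewrite inordK // ltnS -sz_w riordan_le_size.
have sz_u : size (map (@inord n) w) == n by rewrite size_map sz_w.
by exists (Tuple sz_u); rewrite ?inE /= Ew.
Qed.

Definition asc_RP (R : realType) (n : nat) : {poly R} :=
  \sum_(w in RP n) 'X^(asc (map val w)).

Definition real_rooted (R : realType) (p : {poly R}) : Prop :=
  (size p <= 1)%N \/
  forall z : R[i], root (map_poly (real_complex R) p) z -> complex.Im z = 0.

(* Main.v *)
Require Import Defs.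
From mathcomp Require Import all_boot all_order all_algebra.
From mathcomp Require Import reals.
From mathcomp Require Import complex ring zify.

(* With m = n - 1 steps, the number of Riordan sequences with k ascents is
   C(m+1, k) C(m-k-1, k-1) / (m+1).  Up to C(m+1, k) / (m+1) these are the
   coefficients of X times a Fibonacci polynomial, whose zeros are real by a
   continued fraction argument; and multiplying the k-th coefficient by
   N! C(N, k) amounts to applying twice the operator q |-> q(D) X^N, which
   preserves real-rootedness by Hermite-Poulain. *)

Set Implicit Arguments.
Unset Strict Implicit.
Unset Printing Implicit Defensive.

Import Order.TTheory GRing.Theory Num.Theory.
Local Open Scope ring_scope.

(** * Real zeros over [R[i]], and their preservation under p' - a p *)

Definition real_roots (R : rcfType) (p : {poly R[i]}) : Prop :=
  p = 0 \/ forall z, root p z -> complex.Im z = 0.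

Lemma ImV (R : rcfType) (z : R[i]) :
  complex.Im z^-1 = - complex.Im z / (complex.Re z ^+ 2 + complex.Im z ^+ 2).
Proof. by case: z => a b /=; rewrite mulNr. Qed.

(** Inversion flips the sign of the imaginary part; the factor [c], in applications itself an
    imaginary part, treats both half-planes at once. *)
Lemma ImV_ltr0 (R : rcfType) (c : R) (z : R[i]) :
  (c * complex.Im z^-1 < 0) = (0 < c * complex.Im z).
Proof.
have [Im0|Im0] := eqVneq (complex.Im z) 0.
  by rewrite ImV Im0 ?oppr0 ?mul0r ?mulr0 ltxx.
rewrite ImV mulrA pmulr_llt0; last first.
  by rewrite invr_gt0 ltr_wpDl ?sqr_ge0 // lt_def sqr_ge0 sqrf_eq0 Im0.
by rewrite mulrN oppr_lt0.
Qed.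

Lemma ImV_ler0 (R : rcfType) (c : R) (z : R[i]) :
  (c * complex.Im z^-1 <= 0) = (0 <= c * complex.Im z).
Proof.
have [Im0|Im0] := eqVneq (complex.Im z) 0.
  by rewrite ImV Im0 ?oppr0 ?mul0r ?mulr0 lexx.
rewrite ImV mulrA pmulr_lle0; last first.
  by rewrite invr_gt0 ltr_wpDl ?sqr_ge0 // lt_def sqr_ge0 sqrf_eq0 Im0.
by rewrite mulrN oppr_le0.
Qed.

(* Off the real axis, the logarithmic derivative [\sum_a 1 / (z - a)] has
   imaginary part of sign opposite to that of z. *)
Lemma deriv_prod_real_roots (R : rcfType) (s : seq R[i]) (z : R[i]) :
    (forall a, a \in s -> complex.Im a = 0) -> complex.Im z != 0 ->
  exists2 w, (\prod_(a <- s) ('X - a%:P))^`().[z] =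
             w * (\prod_(a <- s) ('X - a%:P)).[z] &
    if s is [::] then w = 0 else complex.Im z * complex.Im w < 0.
Proof.
move=> s_real Im_z; elim: s s_real => [|a s IHs] s_real.
  by exists 0; rewrite // big_nil derivC horner0 mul0r.
have [|w Ew w_sign] := IHs; first by move=> b bs; apply: s_real; rewrite inE bs orbT.
have Ima : complex.Im a = 0 by apply: s_real; rewrite mem_head.
have ImB : complex.Im (z - a) = complex.Im z by rewrite raddfB /= Ima subr0.
have za0 : z - a != 0 by apply: contraNneq Im_z => za; rewrite -ImB za.
have az_sign : complex.Im z * complex.Im (z - a)^-1 < 0.
  by rewrite ImV_ltr0 ImB -expr2 lt_def sqr_ge0 sqrf_eq0 Im_z.
exists ((z - a)^-1 + w).
  rewrite !big_cons derivM derivXsubC mul1r !hornerE /= Ew.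
  by field.
rewrite raddfD /= mulrDr.
case: s w_sign {IHs s_real Ew} => [->|b s w_sign]; first by rewrite /= mulr0 addr0.
by rewrite -[0]addr0 ltrD.
Qed.

(** At a non-real z, p' - a p equals p (w - a) with w the logarithmic derivative of p; for
    nonconstant p, w is not real while [a] is, so neither factor vanishes. *)
Lemma real_roots_derivB (R : rcfType) (p : {poly R[i]}) (a : R[i]) :
  complex.Im a = 0 -> real_roots p -> real_roots (p^`() - a *: p).
Proof.
move=> Ima [->|p_real]; first by left; rewrite deriv0 scaler0 subr0.
have [s Dp] := closed_field_poly_normal p.
have [lc0|lc0] := eqVneq (lead_coef p) 0.
  by left; rewrite Dp lc0 scale0r deriv0 scaler0 subr0.
have s_real b : b \in s -> complex.Im b = 0.
  by move=> bs; apply: p_real; rewrite Dp rootZ // root_prod_XsubC.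
(* A constant p has w = 0, so w - a can vanish only if [a = 0]; the result is then the zero
   polynomial. *)
have [/andP[/eqP Es /eqP Ea]|nontriv] := boolP ((s == [::]) && (a == 0)).
  by left; rewrite Dp Es Ea big_nil scale0r subr0 derivZ derivC scaler0.
right=> z; apply: contraTeq => Im_z.
have [w Ew w_sign] := deriv_prod_real_roots s_real Im_z.
have pz0 : (\prod_(b <- s) ('X - b%:P)).[z] != 0.
  by apply: contraNneq Im_z => pz; rewrite s_real // -root_prod_XsubC; apply/eqP.
rewrite Dp /root derivZ hornerD hornerN !hornerZ Ew.
have -> : lead_coef p * (w * (\prod_(b <- s) ('X - b%:P)).[z]) -
   a * (lead_coef p * (\prod_(b <- s) ('X - b%:P)).[z]) =
  lead_coef p * (\prod_(b <- s) ('X - b%:P)).[z] * (w - a) by ring.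
rewrite !mulf_neq0 //.
case: s w_sign nontriv {Dp s_real Ew pz0} => [->|b s w_sign _]; first by rewrite sub0r oppr_eq0.
apply: contraTneq w_sign => /eqP; rewrite subr_eq0 => /eqP->.
by rewrite Ima mulr0 ltxx.
Qed.

(** * Differential operators q(D) and the Hermite-Poulain theorem *)

Definition poly_diff (R : nzRingType) (q p : {poly R}) : {poly R} :=
  \sum_(i < size q) q`_i *: p^`(i).

Lemma poly_diff_widen (R : nzRingType) (q p : {poly R}) (n : nat) :
  (size q <= n)%N -> poly_diff q p = \sum_(i < n) q`_i *: p^`(i).
Proof.
move=> le_qn; rewrite /poly_diff (big_ord_widen n (fun i => q`_i *: p^`(i))) //.
rewrite big_mkcond; apply: eq_bigr => i _.
by case: ltnP => // le_qi; rewrite nth_default ?scale0r.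
Qed.

Lemma poly_diff_XsubC_mul (R : comNzRingType) (a : R) (q p : {poly R}) :
  poly_diff (('X - a%:P) * q) p = (poly_diff q p)^`() - a *: poly_diff q p.
Proof.
have leq : (size (('X - a%:P) * q)%R <= (size q).+1)%N.
  by apply: leq_trans (size_polyMleq _ _) _; rewrite size_XsubC.
rewrite (poly_diff_widen _ leq) [in RHS]/poly_diff.
rewrite -/(poly_diff q p) {2}(poly_diff_widen p (leqnSn _)).
rewrite raddf_sum scaler_sumr /=.
under [X in _ = X - _]eq_bigr => i _ do rewrite derivZ -derivnS.
(* The added [0] becomes the term [i = 0] of the shifted sum, whose coefficients are those of
   ['X * q]. *)
rewrite -[X in _ = X - _]add0r.
have -> : 0 + \sum_(i < size q) q`_i *: p^`(i.+1) =
   \sum_(i < (size q).+1) (if i == 0%N :> nat then 0 else q`_i.-1) *: p^`(i).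
  by rewrite big_ord_recl scale0r.
rewrite -sumrB; apply: eq_bigr => i _.
by rewrite mulrBl coefB coefXM coefCM scalerBl scalerA.
Qed.

(** Hermite-Poulain: q splits into factors X - a with a real, and each acts as D - a, which keeps
    the zeros real. *)
Lemma real_roots_poly_diff (R : rcfType) (q p : {poly R[i]}) :
  real_roots q -> real_roots p -> real_roots (poly_diff q p).
Proof.
case=> [->|q_real] p_real; first by left; rewrite /poly_diff size_poly0 big_ord0.
have [s Dq] := closed_field_poly_normal q.
have [lc0|lc0] := eqVneq (lead_coef q) 0.
  by left; rewrite Dq lc0 scale0r /poly_diff size_poly0 big_ord0.
have s_real b : b \in s -> complex.Im b = 0.
  by move=> bs; apply: q_real; rewrite Dq rootZ // root_prod_XsubC.
have -> : q = \prod_(b <- s) ('X - b%:P) * (lead_coef q)%:P.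
  by rewrite mulrC mul_polyC.
move: (lead_coef q) lc0 => c c0 {q q_real Dq}.
elim: s s_real => [|a s IHs] s_real.
  rewrite big_nil mul1r /poly_diff size_polyC c0 big_ord1 coefC /=.
  case: p_real => [->|p_real]; first by left; rewrite scaler0.
  by right=> z; rewrite rootZ //; apply: p_real.
rewrite big_cons -mulrA poly_diff_XsubC_mul; apply: real_roots_derivB.
  by apply: s_real; rewrite mem_head.
by apply: IHs => b bs; apply: s_real; rewrite inE bs orbT.
Qed.

Lemma real_roots_Xn (R : rcfType) (n : nat) : real_roots ('X^n : {poly R[i]}).
Proof. by right=> z; rewrite /root hornerXn expf_eq0 => /andP[_ /eqP->]. Qed.

(** Applying q(D) to X^N reverses the coefficients of q and weights the k-th one by N!/k!. *)
Lemma coef_poly_diff_Xn (R : comNzRingType) (q : {poly R}) (N k : nat) :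
  (size q <= N.+1)%N -> (k <= N)%N ->
  (poly_diff q 'X^N)`_k = q`_(N - k) * (N ^_ (N - k))%:R.
Proof.
move=> le_qN le_kN; rewrite (poly_diff_widen _ le_qN) coef_sum.
have lt : (N - k < N.+1)%N by lia.
rewrite (bigD1 (Ordinal lt)) //= big1 ?addr0.
  by rewrite coefZ derivnXn coefMn coefXn subKn // eqxx.
move=> i; rewrite -val_eqE /= => ne; rewrite coefZ derivnXn coefMn coefXn.
have [lt_i|le_i] := boolP (k == N - i)%N; last by rewrite mul0rn mulr0.
have := ltn_ord i; lia.
Qed.

Lemma size_poly_diff_Xn (R : comNzRingType) (q : {poly R}) (N : nat) :
  (size (poly_diff q 'X^N) <= N.+1)%N.
Proof.
rewrite /poly_diff; apply: leq_trans (size_sum _ _ _) _.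
apply/bigmax_leqP => i _; apply: leq_trans (size_scale_leq _ _) _.
rewrite derivnXn -scaler_nat; apply: leq_trans (size_scale_leq _ _) _.
by rewrite size_polyXn ltnS leq_subr.
Qed.

(** In two passes the reversals cancel, and the weights N!/k! and N!/(N-k)! multiply to N! C(N,
    k). *)
Lemma real_roots_mul_bin (R : rcfType) (q : {poly R[i]}) (N : nat) :
  (size q <= N.+1)%N -> real_roots q ->
  real_roots (\poly_(k < N.+1) (q`_k * 'C(N, k)%:R)).
Proof.
move=> le_qN q_real.
have D := real_roots_poly_diff (real_roots_poly_diff q_real (real_roots_Xn R N))
            (real_roots_Xn R N).
have f0 : (N`!%:R : R[i]) != 0 by rewrite pnatr_eq0 -lt0n fact_gt0.
have E : poly_diff (poly_diff q 'X^N) 'X^N =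
  N`!%:R *: \poly_(k < N.+1) (q`_k * 'C(N, k)%:R).
  apply/polyP => k; rewrite coefZ coef_poly ltnS.
  have [le_kN|lt_Nk] := leqP k N; last first.
    by rewrite mulr0 nth_default // (leq_trans (size_poly_diff_Xn _ _)).
  rewrite !coef_poly_diff_Xn ?size_poly_diff_Xn ?leq_subr // subKn //.
  rewrite -mulrA -natrM mulrCA -natrM; congr (_ * _%:R).
  have := ffact_fact le_kN; rewrite -[N ^_ (N - k)]bin_ffact bin_sub // => <-.
  lia.
rewrite E in D; case: D => [D|D].
  by left; move/eqP: D; rewrite scaler_eq0 (negbTE f0) => /eqP.
by right=> z pz; apply: D; rewrite rootZ.
Qed.

(** * Fibonacci polynomials *)

Fixpoint fibonacci_poly (R : nzRingType) (n : nat) : {poly R} :=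
  match n with
  | 0 | 1 => 1
  | (n'.+1 as n1).+1 => fibonacci_poly R n1 + 'X * fibonacci_poly R n'
  end.

Lemma coef_fibonacci_poly (R : nzRingType) (n j : nat) :
  (fibonacci_poly R n)`_j = 'C(n - j, j)%:R.
Proof.
suff H : (forall j, (fibonacci_poly R n)`_j = 'C(n - j, j)%:R) /\
  (forall j, (fibonacci_poly R n.+1)`_j = 'C(n.+1 - j, j)%:R) by case: H.
elim: n {j} => [|n [IHn IHn1]].
  by split=> -[|[|j]]; rewrite coef1 ?bin0.
split=> // -[|j]; rewrite /= coefD coefXM /= ?bin0 ?addr0; first by rewrite IHn1 bin0.
rewrite (IHn j) (IHn1 j.+1) -natrD; congr _%:R.
(* Pascal's rule for [j <= n]; beyond, the truncated subtractions give 0 and all three binomials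
   vanish. *)
rewrite !subSS; have [le_jn|lt_nj] := leqP j n; first by rewrite subSn // binS.
by rewrite (eqP (ltnW lt_nj)) (eqP lt_nj) !bin0n; case: j lt_nj.
Qed.

(* For t off the real axis, the ratios [q] of consecutive values satisfy
   [q' = 1 + t / q], a continued fraction with values in a cone of angle [arg t]. *)
Lemma real_roots_fibonacci_poly (R : rcfType) (n : nat) :
  real_roots (fibonacci_poly R[i] n).
Proof.
right=> t; apply: contraTeq => Im_t.
have t0 : t != 0 by apply: contraNneq Im_t => ->.
have Im_tV : complex.Im t * complex.Im t^-1 < 0.
  by rewrite ImV_ltr0 -expr2 lt_def sqr_ge0 sqrf_eq0 Im_t.
suff [] : (fibonacci_poly R[i] n).[t] != 0 /\ exists q,
  [/\ (fibonacci_poly R[i] n.+1).[t] = q * (fibonacci_poly R[i] n).[t],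
      0 <= complex.Im t * complex.Im q & complex.Im t * complex.Im (q / t) < 0] by [].
elim: n => [|n [Fn0 [q [Eq q_sign qt_sign]]]].
  rewrite !hornerE oner_eq0; split=> //; exists 1.
  by rewrite !mul1r /= mulr0.
have q0 : q != 0 by apply: contraTneq qt_sign => ->; rewrite mul0r mulr0 ltxx.
split; first by rewrite Eq mulf_neq0.
exists (1 + t / q); split.
- rewrite [fibonacci_poly _ _]/= -/(fibonacci_poly _ n.+1) !hornerE /= Eq; by field.
(* [t / q] is the inverse of [q / t], so its imaginary part has the sign of that of [t]. *)
- have := ImV_ltr0 (complex.Im t) (t / q).
  by rewrite invf_div qt_sign raddfD /= add0r => /esym/ltW.
(* The new ratio divided by [t] is 1/t + 1/q; the strict inequality comes from 1/t. *)
- rewrite mulrDl mul1r mulrAC divff // mul1r raddfD /= mulrDr.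
  by rewrite -[0]addr0 ltr_leD // ImV_ler0.
Qed.

(** * Enumeration of Riordan sequences by their first step *)

Lemma asc_cons2 (a b : nat) (s : seq nat) :
  asc [:: a, b & s] = ((a < b) + asc (b :: s))%N.
Proof.
rewrite /asc /= !cardsE -!sum1_card !big_mkcond big_ord_recl /=.
by congr (_ + _)%N; rewrite -big_mkcond.
Qed.

(** Continuations by [m] entries after an entry [h], ending at height 1. From height 1 only an
    ascent is possible: a level step is forbidden there and a descent would reach 0. *)
Fixpoint riordan_tails (m h : nat) : seq (seq nat) :=
  if m is m'.+1 then
    [seq h.+1 :: s | s <- riordan_tails m' h.+1] ++
    (if (1 < h)%N then [seq h :: s | s <- riordan_tails m' h] ++
                   [seq h.-1 :: s | s <- riordan_tails m' h.-1] else [::])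
  else if h == 1%N then [:: [::]] else [::].

Lemma mem_map_cons (T : eqType) (a b : T) (s : seq T) (ss : seq (seq T)) :
  (b :: s \in [seq a :: t | t <- ss]) = (b == a) && (s \in ss).
Proof.
apply/mapP/andP => [[t tss [-> ->]]|[/eqP-> sss]]; first by rewrite eqxx.
by exists s.
Qed.

Lemma nil_map_cons (T : eqType) (a : T) (ss : seq (seq T)) :
  ([::] \in [seq a :: t | t <- ss]) = false.
Proof. by apply/mapP => -[]. Qed.

Lemma mem_riordan_tails (m h : nat) (s : seq nat) : (0 < h)%N ->
  (s \in riordan_tails m h) =
  [&& size s == m, all (fun a => 0 < a)%N s, last h s == 1%N & path riordan_step h s].
Proof.
elim: m h s => [|m IHm] h [|b s] h_gt0 //=.
- by case: (h == 1%N).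
- by case: (h == 1%N).
- rewrite mem_cat nil_map_cons; case: ifP => // _.
  by rewrite mem_cat !nil_map_cons.
rewrite mem_cat mem_map_cons eqSS.
have -> : (b :: s \in if (1 < h)%N then [seq h :: s | s <- riordan_tails m h] ++
                   [seq h.-1 :: s | s <- riordan_tails m h.-1] else [::])
  = (1 < h)%N && ((b == h) && (s \in riordan_tails m h)
       || (b == h.-1) && (s \in riordan_tails m h.-1)).
  by case: ifP => //= _; rewrite mem_cat !mem_map_cons.
have [b_gt0|] := ltnP 0 b; last first.
  rewrite leqn0 => /eqP->; rewrite !andbF /=.
  by case: h h_gt0 => [|[|h]].
rewrite /=.
have E c : (0 < c)%N -> (b == c) && (s \in riordan_tails m c) = (b == c) &&
  [&& size s == m, all (fun a => 0 < a)%N s, last b s == 1%N & path riordan_step b s].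
  by move=> c_gt0; case: eqP => //= ->; rewrite IHm.
rewrite E //.
have -> : (1 < h)%N && ((b == h) && (s \in riordan_tails m h)
       || (b == h.-1) && (s \in riordan_tails m h.-1)) =
   ((1 < h)%N && ((b == h) || (b == h.-1))) &&
  [&& size s == m, all (fun a => 0 < a)%N s, last b s == 1%N & path riordan_step b s].
  case: ltnP => //= h_gt1; rewrite !E ?andb_orl //; lia.
rewrite -andb_orl.
have -> : (b == h.+1) || (1 < h)%N && ((b == h) || (b == h.-1)) = riordan_step h b.
  rewrite /riordan_step; lia.
by case: (riordan_step h b); rewrite ?andbF ?andbT.
Qed.

Lemma uniq_riordan_tails (m h : nat) : (0 < h)%N -> uniq (riordan_tails m h).
Proof.
have cons_inj a : injective (cons (a : nat)) by move=> ? ? [].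
elim: m h => [|m IHm] h h_gt0 /=; first by case: ifP.
rewrite cat_uniq map_inj_uniq // IHm //=.
case: ifP => // h_gt1; rewrite cat_uniq !map_inj_uniq // !IHm ?andbT //=; last by lia.
apply/andP; split; apply/hasPn => -[|b s]; rewrite ?mem_cat ?mem_map_cons ?nil_map_cons //.
  by move=> bs; apply: contraL bs => /andP[/eqP-> _]; rewrite negb_or; lia.
by move=> bs; apply: contraL bs => /andP[/eqP-> _]; lia.
Qed.

(** Dropping the initial 1 is a bijection onto the tails: both lists are duplicate-free with the
    same members. *)
Lemma asc_RP_tails (R : realType) (m : nat) :
  asc_RP R m.+1 = \sum_(s <- riordan_tails m 1) 'X^(asc (1%N :: s)).
Proof.
rewrite /asc_RP -big_enum /=.
pose F (s : seq nat) : {poly R} := 'X^(asc s).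
rewrite -[LHS](big_map (fun w : m.+1.-tuple 'I_m.+2 => map val w) xpredT F).
rewrite -[RHS](big_map (cons 1%N) xpredT F).
apply/perm_big/uniq_perm => [||s].
- rewrite map_inj_uniq ?enum_uniq // => u v /(inj_map val_inj).
  exact: val_inj.
- by rewrite map_inj_uniq ?uniq_riordan_tails // => ? ? [].
apply/mapP/idP => [[u]|].
  rewrite mem_enum => Ru Es.
  have /RP_complete/andP[] : exists2 u, u \in RP m.+1 & map val u = s by exists u.
  rewrite /riordan; case: s {Es} => //= a s /eqP[sz_s] /and4P[/andP[_ s_gt0] /eqP a1 last1 path_s].
  rewrite a1 in last1 path_s *.
  by rewrite mem_map_cons eqxx mem_riordan_tails // sz_s eqxx s_gt0 last1.
case: s => [|a s]; first by rewrite nil_map_cons.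
rewrite mem_map_cons mem_riordan_tails // => /andP[/eqP-> /and4P[/eqP sz_s s_gt0 last1 path_s]].
have /RP_complete[u Ru Eu] : (size (1%N :: s) == m.+1) && riordan (1%N :: s).
  by rewrite /riordan /= sz_s !eqxx s_gt0 last1.
by exists u; rewrite ?mem_enum.
Qed.

(** * Ascent polynomials of tails and their coefficients *)

Definition tails_asc (R : nzRingType) (m h : nat) : {poly R} :=
  \sum_(s <- riordan_tails m h) 'X^(asc (h :: s)).

Lemma tails_asc0 (R : nzRingType) (h : nat) :
  tails_asc R 0 h = (h == 1%N)%:R.
Proof.
rewrite /tails_asc /=; case: eqP => _; last by rewrite big_nil.
by rewrite big_seq1 /asc eq_card0 ?expr0 // => -[].
Qed.

Lemma tails_ascS (R : nzRingType) (m h : nat) : (0 < h)%N ->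
  tails_asc R m.+1 h = 'X * tails_asc R m h.+1 +
    (if (1 < h)%N then tails_asc R m h + tails_asc R m h.-1 else 0).
Proof.
move=> h_gt0; rewrite /tails_asc /= big_cat big_map mulr_sumr /=; congr (_ + _).
  by apply: eq_bigr => s _; rewrite asc_cons2 ltnSn exprS.
case: ifP => _; last by rewrite big_nil.
rewrite big_cat !big_map /=; congr (_ + _); apply: eq_bigr => s _; rewrite asc_cons2.
  by rewrite ltnn.
by rewrite ltnNge leq_pred.
Qed.

(** Going from height [h.+1] to 1 with [k] ascents takes [h + k] descents, hence at least [h + k.*2]
    steps. *)
Lemma coef_tails_asc_small (R : nzRingType) (m h k : nat) :
  (m < h + k.*2)%N -> (tails_asc R m h.+1)`_k = 0.
Proof.
elim: m h k => [|m IHm] h k lt_m.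
  by rewrite tails_asc0 coefMn coef1; case: h k lt_m => [|h] [|k] //=; rewrite ?mulr0n ?mul0rn.
rewrite tails_ascS // coefD coefXM.
rewrite [X in X + _](_ : _ = 0) ?add0r; last first.
  by case: k lt_m => [|k] //= lt_m; apply: IHm; lia.
case: h lt_m => [|h] lt_m /=; first by rewrite coef0.
by rewrite coefD !IHm ?addr0 //; lia.
Qed.

(* In terms of [h = d - k] and [m = k + d + a], this is the coefficient of
   [t^k u^(m-h)] in [(1 - t u^2) (1 + u + t u^2)^m / (1 + u)]. *)
Definition tails_count (k d a : nat) : int :=
  ('C(k + d + a, k) * 'C((d + a).-1, a))%:Z -
  (if k is k'.+1 then 'C(k + d + a, k') * 'C(d + a, a) else 0%N)%:Z.

(** The recursion at height 1, where only the ascent term survives. *)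
Lemma tails_count_ground (k a : nat) :
  tails_count k.+1 k.+1 a = tails_count k k.+1 a.
Proof.
rewrite /tails_count.
have -> : (k.+1 + k.+1 + a = (k + k.+1 + a).+1)%N by lia.
rewrite binS addSn /=.
(* Multiplied by k + 1, both sides become (k+a+1) C(2k+1+a, k) C(k+a, a). *)
have E : ('C(k + k.+1 + a, k.+1) * 'C(k + a, a) =
          'C(k + k.+1 + a, k) * 'C((k + a).+1, a))%N.
  apply/eqP; rewrite -(eqn_pmul2l (ltn0Sn k)); apply/eqP.
  have := mul_bin_left (k + k.+1 + a) k.
  have := mul_bin_down (k + a).+1 a.
  have -> : (k + k.+1 + a - k = (k + a).+1)%N by lia.
  have -> : ((k + a).+1 - a = k.+1)%N by lia.
  move=> /= E1 E2; rewrite mulnA E2 mulnCA -E1; lia.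
move: ('C(_, a)) ('C(_, a)) (k + k.+1 + a)%N E => x y n.
by case: k => [|k]; rewrite ?binS ?bin0; nia.
Qed.

(** The recursion above height 1: [k], [d] and [a] number the ascents, descents and level steps, and
    the first step lowers one of them. *)
Lemma tails_count_rec (k d a : nat) :
  tails_count k d.+1 a =
    (if k is k'.+1 then tails_count k' d.+1 a else 0) +
    (if a is a'.+1 then tails_count k d.+1 a' else 0) + tails_count k d a.
Proof.
rewrite /tails_count.
set m := (k + d + a)%N.
have -> : (k + d.+1 + a = m.+1)%N by lia.
have -> : (d.+1 + a = (d + a).+1)%N by lia.
case: k @m => [|k] /=.
  by case: a => [|a]; rewrite ?addr0 ?add0r ?bin0 ?addSn ?addnS /= ?binS; lia.
case: a => [|a]; rewrite ?addn0 ?addnS ?addSn /= ?bin0 ?binn.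
  by case: k => [|k]; rewrite ?binS ?bin0 /=; lia.
by case: k => [|k]; rewrite ?addSn ?addnS ?binS ?bin0 /= ?binS ?bin0; nia.
Qed.

Lemma coef_tails_asc (R : nzRingType) (k d a : nat) : (k <= d)%N ->
  (tails_asc R (k + d + a) (d - k).+1)`_k = (tails_count k d a)%:~R.
Proof.
move Dm: (k + d + a)%N => m.
elim: m k d a Dm => [|m IHm] k d a Dm le_kd.
  have [-> [-> ->]] : k = 0%N /\ d = 0%N /\ a = 0%N by lia.
  by rewrite tails_asc0 coef1.
rewrite tails_ascS // coefD coefXM.
have [Edk|ne_kd] := eqVneq k d.
  subst d; rewrite subnn coef0 addr0.
  (* For [k = 0] all steps would be level at height 1, which is forbidden; accordingly C(a-1, a) =
     0. *)
  case: k Dm {le_kd} => [|k] Dm /=.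
    by case: a Dm => // a Dm; rewrite /tails_count !add0n bin0 bin_small.
  rewrite tails_count_ground -(IHm k k.+1 a) ?subSnn //; lia.
case: d Dm le_kd ne_kd => [|d] Dm le_kd ne_kd; first by move: ne_kd; lia.
have {}le_kd : (k <= d)%N by lia.
rewrite subSn // ltnS ltn0Sn coefD tails_count_rec rmorphD rmorphD addrA /=.
congr (_ + _ + _).
- case: k Dm le_kd {ne_kd} => [|k] Dm le_kd //.
  rewrite -(IHm k d.+1 a) ?[in RHS]subSn //=; [|lia..].
  by congr (tails_asc _ _ _)`_ _; lia.
(* For [a = 0] a level step leaves too few steps for the ascents and descents. *)
- case: a Dm => [|a] Dm; first by rewrite coef_tails_asc_small //; lia.
  by rewrite -(IHm k d.+1 a) ?subSn //; lia.
- by rewrite -(IHm k d a) //; lia.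
Qed.

Lemma tails_count_diag (k a : nat) :
  (k.+1 + k.+1 + a).+1%:Z * tails_count k.+1 k.+1 a =
  ('C((k.+1 + k.+1 + a).+1, k.+1) * 'C(k + a, k))%:Z.
Proof.
have E1 := mul_bin_diag (k.+1 + k.+1 + a).+1 k.
have E2 := mul_bin_left (k.+1 + k.+1 + a) k.
have E3 := mul_bin_diag (k + a).+1 k.
have Ea : 'C(k + a, a) = 'C(k + a, k) by rewrite -[RHS]bin_sub ?leq_addr // addKn.
have EaS : 'C((k + a).+1, a) = 'C((k + a).+1, k.+1).
  by rewrite -[RHS]bin_sub ?ltnS ?leq_addr // subSS addKn.
have {}E2 : (k.+1 * 'C(k.+1 + k.+1 + a, k.+1) = (k + a).+2 * 'C(k.+1 + k.+1 + a, k))%N.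
  by rewrite E2; congr (_ * _)%N; lia.
rewrite /tails_count [(k.+1 + a)%N]addSn -[_.+1.-1]/(k + a)%N Ea EaS.
(* The factor k + 1 lets the absorption identities [E1], [E2], [E3] apply without division. *)
apply: (mulfI (_ : k.+1%:Z != 0)) => //.
rewrite -[_.+1.-1]/(k.+1 + k.+1 + a)%N in E1; rewrite -[_.+1.-1]/(k + a)%N in E3.
move: ('C(_.+1, k.+1)) ('C(k.+1 + k.+1 + a, k.+1)) ('C(k.+1 + k.+1 + a, k)) E1 E2 => c1 c2 x E1 E2.
move: ('C(_.+1, k.+1)) ('C(_, k)) E3 => c3 y E3.
have -> : k.+1%:Z * ((k.+1 + k.+1 + a).+1%:Z * ((c2 * y)%N%:Z - (x * c3)%N%:Z)) =
  (k.+1 + k.+1 + a).+1%:Z * ((k.+1 * c2)%N%:Z * y%:Z - x%:Z * (k.+1 * c3)%N%:Z).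
  by rewrite !PoszM; ring.
rewrite E2 -E3 -[RHS]PoszM mulnA -E1 !PoszM.
by rewrite [(k + a).+2%:Z]intS; ring.
Qed.

(** * Coefficients of [asc_RP] and real-rootedness *)

Lemma size_fibonacci_poly (R : nzRingType) (n : nat) :
  (size (fibonacci_poly R n) <= n.+1)%N.
Proof.
apply/leq_sizeP => j lt_nj; rewrite coef_fibonacci_poly bin_small //; lia.
Qed.

Lemma coef_asc_RP (R : realType) (m k : nat) : (1 < m)%N ->
  m.+1%:R * (asc_RP R m.+1)`_k = ('X * fibonacci_poly R (m - 2))`_k * 'C(m.+1, k)%:R.
Proof.
move=> m_gt1; rewrite asc_RP_tails -/(tails_asc R m 1) coefXM.
case: k => [|k] /=.
  have := @coef_tails_asc R 0 0 m isT; rewrite subnn !add0n => ->.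
  by rewrite /tails_count !add0n (@bin_small m.-1) ?muln0 ?mulr0 ?mul0r //; lia.
rewrite coef_fibonacci_poly.
(* A return to height 1 needs as many descents as ascents. Past this bound both sides vanish;
   [1 < m] then forces [k] to be positive, so the binomial is indeed 0. *)
have [le_km|lt_mk] := leqP k.+1.*2 m; last first.
  rewrite coef_tails_asc_small ?add0n // bin_small ?mul0r ?mulr0 //; lia.
have [a Dm] : exists a, m = (k.+1 + k.+1 + a)%N by exists (m - k.+1.*2)%N; lia.
have := @coef_tails_asc R k.+1 k.+1 a (leqnn _); rewrite subnn -Dm => ->.
have -> : (m - 2 - k = k + a)%N by lia.
have := congr1 (intr : int -> R) (tails_count_diag k a).
by rewrite rmorphM /= -Dm mulnC -!pmulrn natrM => ->.
Qed.

Theorem corollary6p14 (R : realType) (n : nat) : real_rooted (asc_RP R n).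
Proof.
(* An ascent and its matching descent take two steps, so sizes 1 and 2 give constants. *)
have small m : (m <= 1)%N -> (size (asc_RP R m.+1) <= 1)%N.
  move=> m_le1; rewrite asc_RP_tails; apply/leq_sizeP => j j_gt0.
  by apply: coef_tails_asc_small; lia.
case: n => [|m].
  left; rewrite /asc_RP; apply: leq_trans (size_sum _ _ _) _.
  apply/bigmax_leqP => w _; rewrite (tuple0 w) /asc eq_card0 ?expr0 ?size_poly1 //.
  by case.
have [/small|m_gt1] := leqP m 1; first by left.
have fib : real_roots ('X * fibonacci_poly R[i] (m - 2)).
  have [->|fib_real] := real_roots_fibonacci_poly R (m - 2); first by left; rewrite mulr0.
  by right=> z; rewrite rootM rootX => /orP[/eqP->|/fib_real].
have size_fib : (size ('X * fibonacci_poly R[i] (m - 2))%R <= m.+2)%N.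
  apply: leq_trans (size_polyMleq _ _) _.
  by rewrite size_polyX ltnS; apply: leq_trans (size_fibonacci_poly _ _) _; lia.
(* The weights C(N, k) are taken with N = m + 1; the nonzero scalar m + 1 does not affect the
   zeros. *)
have Dasc : \poly_(k < m.+2) (('X * fibonacci_poly R[i] (m - 2))`_k * 'C(m.+1, k)%:R) =
    m.+1%:R *: map_poly (real_complex R) (asc_RP R m.+1).
  apply/polyP => k; rewrite coef_poly coefZ coef_map /=.
  have -> : (m.+1%:R : R[i]) = real_complex R m.+1%:R by rewrite rmorph_nat.
  rewrite -rmorphM coef_asc_RP // !coefXM !coef_fibonacci_poly rmorphM rmorph_nat.
  case: ltnP => [_|le_mk]; last by rewrite (bin_small le_mk) mulr0.
  by case: (k == 0%N); rewrite ?rmorph0 ?rmorph_nat.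
have m0 : (m.+1%:R : R[i]) != 0 by rewrite pnatr_eq0.
have := real_roots_mul_bin size_fib fib; rewrite Dasc => -[/eqP|asc_real].
  rewrite scaler_eq0 (negbTE m0) map_poly_eq0 /= => /eqP->.
  by left; rewrite size_poly0.
by right=> z asc_z; apply: asc_real; rewrite rootZ.
Qed.
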